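(* A queue behavior $b$ is legal if and only if $b$ has a sequential witness.
   Context: A queue event is a tuple $(u,m,d_{in},d_{out})$ with a globally unique identifier $u\in\mathbb{N}$ and method $m\in\{\mathtt{enq},\mathtt{deq}\}$; an enqueue event of value $x\in\mathbb{N}$ is $\mathtt{enq}^u(x)=(u,\mathtt{enq},x,\bot)$ and a dequeue event returning $x\in\mathbb{N}\cup\{\mathtt{NULL}\}$ is $\mathtt{deq}^u(x)=(u,\mathtt{deq},\bot,x)$ ($\mathtt{NULL}\notin\mathbb{N}$). A queue behavior is a finite duplicate-free sequence of queue events. The labelled transition system $\mathsf{LTS}_Q$ has as states finite sequences over $\mathbb{N}$, initial state the empty sequence $\varepsilon$, and transitions $q\xrightarrow{\mathtt{enq}(x)}q\cdot x$, $x\cdot q'\xrightarrow{\mathtt{deq}(x)}q'$ for $x\in\mathbb{N}$, and $\varepsilon\xrightarrow{\mathtt{deq}(\mathtt{NULL})}\varepsilon$ (identifiers are ignored by transitions). A behavior is legal if it is the sequence of labels of some run of $\mathsf{LTS}_Q$ from $\varepsilon$. For a behavior $b$: $\mathrm{Enq}(b)$, $\mathrm{Deq}(b)$ are its enqueue and dequeue events, $\mathrm{Val}(b,e)$ is the value enqueued or returned by $e$, and $e\prec_b e'$ means $e$ occurs before $e'$ in $b$. A sequential witness for $b$ is a total map $\mu:\mathrm{Deq}(b)\to\mathrm{Enq}(b)\cup\{\bot\}$ such that: (i) $\mu(d)=e$ implies $\mathrm{Val}(b,d)=\mathrm{Val}(b,e)$; (ii) $\mu(d)=\bot$ iff $\mathrm{Val}(b,d)=\mathtt{NULL}$;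 (iii) $\mu(d)=\mu(d')\neq\bot$ implies $d=d'$; (iv) $\mu(d)=e$ implies $e\prec_b d$; (v) if $e\prec_b\mu(d')$ then there is $d$ with $\mu(d)=e$ and $d\prec_b d'$; (vi) $\mu(d)=\bot$ implies $|\{e\in\mathrm{Enq}(b)\mid e\prec_b d\}|=|\{d'\in\mathrm{Deq}(b)\mid d'\prec_b d,\ \mu(d')\neq\bot\}|$. *)

(* Defs.v *)
From HB Require Import structures.
From mathcomp Require Import all_boot.

Set Implicit Arguments.
Unset Strict Implicit.
Unset Printing Implicit Defensive.

(* [Enq u x] is the tuple (u, enq, x, bot) and [Deq u y] is (u, deq, bot, y),
   [y = None] standing for NULL. *)
Inductive qevent : Type :=
  | Enq of nat & nat
  | Deq of nat & option nat.

Definition qevent_code (e : qevent) : (nat * nat) + (nat * option nat) :=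
  match e with Enq u x => inl (u, x) | Deq u y => inr (u, y) end.

Definition qevent_decode (c : (nat * nat) + (nat * option nat)) : qevent :=
  match c with inl (u, x) => Enq u x | inr (u, y) => Deq u y end.

Lemma qevent_codeK : cancel qevent_code qevent_decode.
Proof. by case. Qed.

HB.instance Definition _ := Countable.copy qevent (can_type qevent_codeK).

Definition is_enq (e : qevent) : bool := if e is Enq _ _ then true else false.

Definition is_deq (e : qevent) : bool := if e is Deq _ _ then true else false.

(* The value enqueued or returned; it does not depend on the behavior. *)
Definition value (e : qevent) : option nat :=
  match e with Enq _ x => Some x | Deq _ y => y end.

Definition queue_behavior (b : seq qevent) : bool := uniq b.

Inductive label : Type :=
  | LEnq of nat
  | LDeq of option nat.

Definition label_of (e : qevent) : label :=
  match e with Enq _ x => LEnq x | Deq _ y => LDeq y end.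

Inductive step : seq nat -> label -> seq nat -> Prop :=
  | step_enq q x : step q (LEnq x) (rcons q x)
  | step_deq x q : step (x :: q) (LDeq (Some x)) q
  | step_null : step [::] (LDeq None) [::].

Inductive run : seq nat -> seq label -> seq nat -> Prop :=
  | run_nil q : run q [::] q
  | run_cons q l q' ls q'' : step q l q' -> run q' ls q'' -> run q (l :: ls) q''.

Definition legal (b : seq qevent) : Prop :=
  exists q, run [::] (map label_of b) q.

Definition enqs (b : seq qevent) : seq qevent := [seq e <- b | is_enq e].

Definition deqs (b : seq qevent) : seq qevent := [seq e <- b | is_deq e].

Definition EnqOf (b : seq qevent) : finType := seq_sub (enqs b).

Definition DeqOf (b : seq qevent) : finType := seq_sub (deqs b).

(* Meaningful for duplicate-free [b], where the first index is the only one. *)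
Definition before (b : seq qevent) (e e' : qevent) : bool :=
  [&& e \in b, e' \in b & index e b < index e' b].

Record sequential_witness (b : seq qevent) (mu : DeqOf b -> option (EnqOf b)) :
    Prop := SequentialWitness {
  sw_value : forall (d : DeqOf b) (e : EnqOf b),
    mu d = Some e -> value (val d) = value (val e);
  sw_null : forall d : DeqOf b,
    mu d = None <-> value (val d) = None;
  sw_inj : forall d d' : DeqOf b,
    mu d = mu d' -> mu d <> None -> d = d';
  sw_before : forall (d : DeqOf b) (e : EnqOf b),
    mu d = Some e -> before b (val e) (val d);
  sw_fifo : forall (e e' : EnqOf b) (d' : DeqOf b),
    mu d' = Some e' -> before b (val e) (val e') ->
    exists2 d : DeqOf b, mu d = Some e & before b (val d) (val d');
  sw_empty : forall d : DeqOf b,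
    mu d = None ->
    #|[set e : EnqOf b | before b (val e) (val d)]|
    = #|[set d' : DeqOf b | before b (val d') (val d) & mu d' != None]|
}.

Definition has_sequential_witness (b : seq qevent) : Prop :=
  exists mu : DeqOf b -> option (EnqOf b), sequential_witness mu.

(* Main.v *)
Require Import Defs.
From mathcomp Require Import all_boot.

(** In a FIFO queue the value returned by a dequeue is forced: it is the k-th
    enqueued value so far (counting from 0), where k is the number of earlier
    successful dequeues, or NULL if there is no such value.  Legality says
    exactly this of every dequeue.  Under this condition, sending a dequeue to
    the k-th enqueue before it is a sequential witness.  Conversely, if a
    witness sends d to e, it restricts to a bijection from the successful
    dequeues before d to the enqueues before e, so e is the k-th enqueue. *)

Set Implicit Arguments.
Unset Strict Implicit.
Unset Printing Implicit Defensive.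

(** * Positions and counts in sequences *)

Section SeqFacts.

Lemma onth_drop_head (T : Type) (s : seq T) k : onth s k = ohead (drop k s).
Proof. by elim: s k => [|x s IHs] [|k] //=; rewrite IHs. Qed.

Variable T : eqType.
Implicit Types (s : seq T) (x : T) (a : pred T).

Lemma index_filter a s x :
  x \in s -> a x -> index x (filter a s) = count a (take (index x s) s).
Proof.
elim: s => //= y s IHs; rewrite inE.
have [<- _ ax|nxy /= xs ax] := eqVneq x y; first by rewrite ax /= eqxx.
by case: (a y); rewrite /= ?(negPf nxy) 1?eq_sym ?(negPf nxy) IHs.
Qed.

(** The inequality is strict because [x] itself is counted on the right, while the prefix on the
    left stops just short of it. *)
Lemma ltn_count_take a s x i :
  x \in take i s -> a x -> count a (take (index x s) s) < count a (take i s).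
Proof.
elim: s i => [|y s IHs] [|i] //=; rewrite inE eq_sym.
have [-> _ ->|nyx xs ax] //= := eqVneq y x.
by rewrite ltn_add2l IHs.
Qed.

End SeqFacts.

(** Turns the cardinalities in the emptiness condition of a witness into lengths of filtered
    prefixes. *)
Lemma card_seq_sub (T : choiceType) (s : seq T) (P : pred (seq_sub s)) t :
  uniq t -> (forall x : seq_sub s, P x = (val x \in t)) -> {subset t <= s} ->
  #|[set x | P x]| = size t.
Proof.
move=> Ut Pt ts; rewrite cardE -(size_map val); apply/perm_size/uniq_perm => //.
  by rewrite map_inj_uniq ?enum_uniq //; apply: val_inj.
move=> x; apply/mapP/idP => [[y + ->]|xt]; first by rewrite mem_enum inE Pt.
by exists (SeqSub (ts _ xt)); rewrite // mem_enum inE Pt.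
Qed.

(** * The queue state as a function of the behavior *)

Definition enq_value (e : qevent) : option nat :=
  if e is Enq _ x then Some x else None.

Definition enq_values (b : seq qevent) : seq nat := pmap enq_value b.

Definition pops (e : qevent) : bool := is_deq e && (value e != None).

Definition past (b : seq qevent) (e : qevent) : seq qevent :=
  take (index e b) b.

Definition next_value (b : seq qevent) : option nat :=
  onth (enq_values b) (count pops b).

Lemma onth_enq_values b k :
  onth (enq_values b) k = obind value (onth (enqs b) k).
Proof.
elim: b k => [|[u x|u y] b IHb] k; [by case: k | by case: k | exact: IHb].
Qed.

Lemma size_enq_values b : size (enq_values b) = size (enqs b).
Proof. by elim: b => [|[u x|u y] b IHb] //=; rewrite IHb. Qed.

Lemma enq_values_rcons b e :
  enq_values (rcons b e) =
  if e is Enq _ x then rcons (enq_values b) x else enq_values b.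
Proof.
rewrite -cats1 /enq_values pmap_cat.
by case: e => u x /=; rewrite ?cats1 ?cats0.
Qed.

Lemma count_pops_rcons b e : count pops (rcons b e) = count pops b + pops e.
Proof. by rewrite -cats1 count_cat /= addn0. Qed.

(** Runs unfold from the front, but the inductions on behaviors below add the last event. *)
Lemma run_rcons q ls l q' :
  run q (rcons ls l) q' <-> exists2 r, run q ls r & step r l q'.
Proof.
split.
  elim: ls q => [|l0 ls IHls] q /= H; inversion H; subst.
    by exists q; [constructor | inversion H5; subst].
  by have [r ? ?] := IHls _ H5; exists r => //; econstructor; eauto.
case=> r H; elim: H => {q ls r} [q|q l0 r ls r' st _ IH] H.
  by econstructor; eauto; constructor.
by econstructor; eauto.
Qed.

(** Enqueues extend the list of all enqueued values, and successful dequeues only advance a pointer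
    into it. The bound must be carried along: dropping commutes with appending a value only while
    the pointer is within the list. *)
Lemma run_state b q : run [::] (map label_of b) q ->
  count pops b <= size (enq_values b) /\
  q = drop (count pops b) (enq_values b).
Proof.
elim/last_ind: b q => [|b e IHb] q /=; first by move=> H; inversion H.
rewrite map_rcons => /run_rcons[r /IHb[le_b r_eq] st].
rewrite count_pops_rcons enq_values_rcons.
move El: (label_of e) st => l st.
case: st El r_eq le_b => {r q l} [r v|v r|]; case: e => u x //= [->] r_eq le_b.
- by rewrite addn0 size_rcons drop_rcons -?r_eq // leqW.
(* The state before a successful dequeue is nonempty, so the old count is strictly below the
   length. *)
- rewrite /pops /= addn1; split; first by rewrite -subn_gt0 -size_drop -r_eq.
  by rewrite -add1n -drop_drop -r_eq /= drop0.
- by rewrite addn0.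
Qed.

Lemma legal_rcons b e :
  legal (rcons b e) <-> legal b /\ (is_deq e -> value e = next_value b).
Proof.
rewrite /legal map_rcons /next_value onth_drop_head; split.
  case=> q /run_rcons[r Hr st]; have [_ r_eq] := run_state Hr.
  split; first by exists r.
  by rewrite -r_eq; case: e st => u x //= st _; inversion st.
case=> -[q Hq] He; have [_ q_eq] := run_state Hq; rewrite -q_eq in He.
suff [r st] : exists r, step q (label_of e) r.
  by exists r; apply/run_rcons; exists q.
case: e He => u x /= He; first by eexists; constructor.
(* Returning [ohead q] is always possible: a head can be popped, and the empty state answers
   NULL. *)
by rewrite He //; case: (q) => [|y r]; eexists; constructor.
Qed.

Lemma legal_catl b c : legal (b ++ c) -> legal b.
Proof.
elim/last_ind: c => [|c e IHc]; first by rewrite cats0.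
by rewrite -rcons_cat => /legal_rcons[/IHc].
Qed.

(** Iterates [legal_rcons]: appending a new event leaves the past of every earlier one unchanged. *)
Lemma legalP b : uniq b ->
  legal b <-> forall d, d \in b -> is_deq d -> value d = next_value (past b d).
Proof.
elim/last_ind: b => [_|b e IHb]; first by split => // _; exists [::]; constructor.
rewrite rcons_uniq => /andP[neb /IHb {}IHb].
have past_b d : d \in b -> past (rcons b e) d = past b d.
  by move=> db; rewrite /past -cats1 index_cat db takel_cat ?index_size.
have past_e : past (rcons b e) e = b.
  by rewrite /past -cats1 index_pivot // take_size_cat.
split=> [/legal_rcons[/IHb Hb He] d|H].
  rewrite mem_rcons inE => /predU1P[->|db]; first by rewrite past_e.
  by rewrite past_b //; apply: Hb.
apply/legal_rcons; split=> [|de].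
  by apply/IHb => d db dd; rewrite -past_b // H // mem_rcons inE db orbT.
by rewrite H ?past_e // mem_rcons mem_head.
Qed.

(** * Ranks of events in a duplicate-free behavior *)

Section Witness.

Variable b : seq qevent.
Hypothesis Ub : uniq b.

Lemma enqP (e : EnqOf b) : is_enq (val e) /\ val e \in b.
Proof. by have := ssvalP e; rewrite mem_filter => /andP. Qed.

Lemma deqP (d : DeqOf b) : is_deq (val d) /\ val d \in b.
Proof. by have := ssvalP d; rewrite mem_filter => /andP. Qed.

Lemma beforeE x y : before b x y = (y \in b) && (x \in past b y).
Proof.
rewrite /before; have [xb|nxb] /= := boolP (x \in b); first by rewrite in_take.
by case: (y \in b) => //=; apply/esym/negP => /mem_take; apply/negP.
Qed.

Lemma before_total x y : x \in b -> y \in b -> x <> y ->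
  before b x y \/ before b y x.
Proof.
move=> xb yb nxy; rewrite /before xb yb /=.
case: ltngtP => [||/index_inj xy]; [by left | by right |].
by case: nxy; apply: xy.
Qed.

Lemma card_enq_before y : y \in b ->
  #|[set e : EnqOf b | before b (val e) y]| = size (enqs (past b y)).
Proof.
move=> yb; apply: card_seq_sub.
- by rewrite filter_uniq ?take_uniq.
- by move=> e; rewrite beforeE yb mem_filter (enqP e).1.
- by move=> x; rewrite !mem_filter => /andP[-> /mem_take].
Qed.

Lemma card_pops_before (P : pred (DeqOf b)) y : y \in b ->
  (forall d, P d = (value (val d) != None)) ->
  #|[set d : DeqOf b | before b (val d) y & P d]| = count pops (past b y).
Proof.
move=> yb PE; rewrite -size_filter; apply: card_seq_sub.
- by rewrite filter_uniq ?take_uniq.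
- by move=> d; rewrite beforeE yb mem_filter PE /pops (deqP d).1 andbC.
- by move=> x; rewrite !mem_filter => /andP[/andP[-> _] /mem_take].
Qed.

(** The enqueues before [y] form a prefix of all enqueues, so the rank of [e] is the same in both
    lists. *)
Lemma onth_enqs_past (e : EnqOf b) y k :
  y \in b ->
  (onth (enqs (past b y)) k = Some (val e) <->
   before b (val e) y /\ k = size (enqs (past b (val e)))).
Proof.
move=> yb; have [ee eb] := enqP e.
rewrite beforeE yb /= size_filter -index_filter //.
have index_past x : x \in enqs (past b y) ->
    index x (enqs b) = index x (enqs (past b y)).
  by move=> xy; rewrite -{1}(cat_take_drop (index y b) b) /enqs filter_cat
    index_cat [_ \in _]xy.
split=> [ek|[ey ->]].
  have ey : val e \in enqs (past b y) by apply/onthP; exists k.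
  split; first by move: ey; rewrite mem_filter => /andP[].
  rewrite index_past //.
  have kU : k < size (enqs (past b y)) by rewrite -onthTE ek.
  by rewrite -(onth_nth (val e) _ _ _ ek) index_uniq // filter_uniq ?take_uniq.
have {}ey : val e \in enqs (past b y) by rewrite mem_filter ee.
rewrite index_past // onthE (nth_map (val e)) ?index_mem //.
by rewrite nth_index.
Qed.

Lemma legal_of_witness (mu : DeqOf b -> option (EnqOf b)) :
  sequential_witness mu -> legal b.
Proof.
move=> W; apply/legalP => // d0 db dd.
have d0D : d0 \in deqs b by rewrite mem_filter dd.
pose d : DeqOf b := SeqSub d0D; rewrite -[d0]/(val d).
have muN d' : (mu d' != None) = (value (val d') != None).
  by congr negb; apply/eqP/eqP => /(sw_null W).
rewrite /next_value onth_enq_values; case mud: (mu d) => [e|]; last first.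
  rewrite ((sw_null W d).1 mud); have := sw_empty W mud.
  rewrite card_enq_before // card_pops_before // => <-.
  by rewrite onth_default.
(* In the NULL case, just closed, the emptiness condition makes the index equal to the length, hence
   out of range. *)
have [ee eb] := enqP e.
suff /(onth_enqs_past _ _ db) -> : before b (val e) (val d) /\
    count pops (past b (val d)) = size (enqs (past b (val e))).
  exact: sw_value W _ _ mud.
split; first exact: sw_before W _ _ mud.
rewrite -(card_pops_before db muN) -card_enq_before //.
(* As [mu] is injective on successful dequeues, it suffices that it maps those before [d] onto the
   enqueues before [e]. *)
rewrite -[RHS](card_imset _ (@Some_inj _)) -(card_in_imset (f := mu)); last first.
  by move=> d1 d2; rewrite inE => /andP[_ /eqP nd1] _ /(sw_inj W); apply.
apply: eq_card => o; apply/imsetP/imsetP => [[d1]|[e1]].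
  rewrite inE => /andP[d1d]; case mud1: (mu d1) => [e1|] // _ ->.
  exists e1; rewrite // inE.
  have ne1e : val e1 <> val e.
    move=> /val_inj e1e; move: d1d; rewrite e1e -mud in mud1.
    rewrite (sw_inj W mud1) ?mud1 ?mud //.
    by rewrite /before ltnn !andbF.
  (* If [e] preceded [e1], the FIFO condition would put a dequeue of [e] before [d1]; by injectivity
     that is [d], which comes after [d1]. *)
  have [//|ee1] := before_total (enqP e1).2 eb ne1e.
  have [d2 mud2 d2d1] := sw_fifo W mud1 ee1.
  have d2d : d2 = d by apply: (sw_inj W); rewrite mud2 ?mud.
  move: d1d d2d1; rewrite d2d => /and3P[_ _ +] /and3P[_ _].
  by move=> lt1 /(ltn_trans lt1); rewrite ltnn.
rewrite inE => e1e ->; have [d1 mud1 d1d] := sw_fifo W mud e1e.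
by exists d1; rewrite ?mud1 // inE d1d mud1.
Qed.

(** * The matching by rank and its witness conditions *)

Definition fifo_match (d : DeqOf b) : option (EnqOf b) :=
  obind insub (onth (enqs (past b (val d))) (count pops (past b (val d)))).

Lemma fifo_matchP d e :
  fifo_match d = Some e <->
  before b (val e) (val d) /\
  count pops (past b (val d)) = size (enqs (past b (val e))).
Proof.
apply: iff_trans _ (onth_enqs_past _ _ (deqP d).2); rewrite /fifo_match.
case: onth => [x|] //=; split=> [|[->]]; last by rewrite valK.
by case: insubP => // e' _ <- [->].
Qed.

(** The [insub] never fails, since anything found in the list is an enqueue of [b]; only an index
    out of range gives [None]. *)
Lemma fifo_match_None d :
  fifo_match d = None <->
  onth (enqs (past b (val d))) (count pops (past b (val d))) = None.
Proof.
rewrite /fifo_match; case ek: onth => [x|] //=; split=> //.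
have: x \in enqs (past b (val d)) by apply/onthP; eexists; exact: ek.
rewrite mem_filter => /andP[xe /mem_take xb].
by case: insubP => //; rewrite mem_filter xe xb.
Qed.

Lemma fifo_match_witness : legal b -> sequential_witness fifo_match.
Proof.
move=> Lb; have Hv (d : DeqOf b) : value (val d) =
    obind value (onth (enqs (past b (val d))) (count pops (past b (val d)))).
  have [dd db] := deqP d.
  by rewrite -onth_enq_values; apply: (legalP Ub).1.
have muV d e : fifo_match d = Some e -> value (val d) = value (val e).
  by rewrite Hv => /fifo_matchP/(onth_enqs_past _ _ (deqP d).2) ->.
have muN d : fifo_match d = None <-> value (val d) = None.
  case mud: (fifo_match d) => [e|].
    by rewrite (muV _ _ mud); have [] := enqP e; case: (val e).
  by split=> // _; rewrite Hv; move/fifo_match_None: mud => ->.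
have popsP d e : fifo_match d = Some e -> pops (val d).
  by move=> mud; rewrite /pops (deqP d).1; apply/eqP => /muN; rewrite mud.
split=> //.
- move=> d d'; case mud: (fifo_match d) => [e|] // /esym mud' _.
  apply/eqP/negPn/negP => /eqP ndd'.
  have {}ndd' : val d <> val d' by move=> /val_inj.
  (* Both dequeues have equally many pops before them, yet the earlier one is itself a pop counted
     for the later one. *)
  move/fifo_matchP: (mud) => [_ kd]; move/fifo_matchP: (mud') => [_ kd'].
  have [] := before_total (deqP d).2 (deqP d').2 ndd'; rewrite beforeE => /andP[_].
    move=> /ltn_count_take /(_ (popsP _ _ mud)).
    by rewrite -/(past _ _) kd -kd' ltnn.
  move=> /ltn_count_take /(_ (popsP _ _ mud')).
  by rewrite -/(past _ _) kd' -kd ltnn.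
- by move=> d e /fifo_matchP[].
- move=> e e' d' /fifo_matchP[e'd' kd'] ee'.
  have [ed eb] := enqP e; have [_ d'b] := deqP d'.
  (* The dequeue sought for [e] is the pop of the same rank [k]. It exists before [d'] because [e]
     has smaller rank than [e'], whose rank is the number of pops before [d']. *)
  pose k := size (enqs (past b (val e))).
  have ltk : k < count pops (past b (val d')).
    rewrite kd' /k !size_filter; apply: ltn_count_take => //.
    by move: ee'; rewrite beforeE => /andP[].
  pose s := [seq x <- past b (val d') | pops x].
  have ks : k < size s by rewrite size_filter.
  pose x := nth (val d') s k.
  have xs : x \in s by rewrite mem_nth.
  move: (xs); rewrite mem_filter => /andP[px xd'].
  have xb : x \in b := mem_take xd'.
  have xD : x \in deqs b by rewrite mem_filter xb andbT; case/andP: px.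
  pose d : DeqOf b := SeqSub xD.
  have kx : count pops (past b x) = k.
    rewrite /past -index_filter // -(cat_take_drop (index (val d') b) b).
    rewrite filter_cat index_cat xs index_uniq //.
    by rewrite filter_uniq ?take_uniq.
  exists d; last by rewrite beforeE d'b.
  case mud: (fifo_match d) => [e1|]; last first.
    by case/andP: px => _; rewrite -[x]/(val d) ((muN d).1 mud) eqxx.
  move/fifo_matchP: mud => [_]; rewrite /= kx /k !size_filter => k1.
  (* Two enqueues of equal rank have equal index in [enqs b], hence coincide. *)
  congr Some; apply: val_inj; have [ed1 eb1] := enqP e1.
  apply: (index_inj (val e) (ssvalP e1) (ssvalP e)).
  by rewrite !index_filter.
- move=> d mud; have [_ db] := deqP d.
  rewrite card_enq_before // card_pops_before //; last first.
    by move=> d'; congr negb; apply/eqP/eqP => /muN.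
  (* One inequality says that the index is out of range; the other is the bound of [run_state] for
     the past of [d], which is legal as a prefix of [b]. *)
  apply/eqP; rewrite eqn_leq -onthNE ((fifo_match_None d).1 mud) /=.
  rewrite -size_enq_values.
  have [q /run_state[]] // : legal (past b (val d)).
  by apply: (legal_catl (c := drop (index (val d) b) b)); rewrite cat_take_drop.
Qed.

End Witness.

Theorem theorem3p10 (b : seq qevent) (hb : queue_behavior b) :
  legal b <-> has_sequential_witness b.
Proof.
split=> [Lb|[mu W]]; last exact: (legal_of_witness hb W).
by exists (@fifo_match b); apply: fifo_match_witness.
Qed.
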